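(* Let $f:\mathbb{R}^d\to\mathbb{R}$ be convex and differentiable with Lipschitz continuous gradient (Lipschitz constant $L$), let $g:\mathbb{R}^d\to\mathbb{R}\cup\{+\infty\}$ and $h:\mathbb{R}^{d'}\to\mathbb{R}\cup\{+\infty\}$ be proper, convex and closed functions, let $A:\mathbb{R}^d\to\mathbb{R}^{d'}$ be a linear map and let $\lambda,\mu>0$. Assume that $\partial(\lambda g+\mu\, h\circ A)(u)=\lambda\,\partial g(u)+\mu A^T\partial h(Au)$ for all $u\in\mathbb{R}^d$, and that the problem $$\min_{u\in\mathbb{R}^d} F_{\lambda,\mu}(u),\qquad F_{\lambda,\mu}(u)=f(u)+\lambda g(u)+\mu h(Au),$$ has a minimizer $\hat u$ (with $F_{\lambda,\mu}(\hat u)<+\infty$). Let $\alpha,\beta>0$ satisfy $\beta\|A\|^2<1/\alpha-L/2$, and let $(\lambda_n)_{n\in\mathbb{N}},(\mu_n)_{n\in\mathbb{N}}$ be sequences of strictly positive real numbers such that $$\sum_{n\in\mathbb{N}}|\lambda_n-\lambda|<\infty\quad\text{and}\quad\sum_{n\in\mathbb{N}}|\mu_n-\mu|<\infty .$$ Then for any starting point $(u_0,v_0)\in\mathbb{R}^d\times\mathbb{R}^{d'}$, the sequence $(u_n)_{n\in\mathbb{N}}$ defined by $$u_{n+1}=\operatorname{prox}_{\alpha\lambda_n g}\bigl(u_n-\alpha\nabla f(u_n)-\alpha\mu_nA^Tv_n\bigr),$$ $$v_{n+1}=\operatorname{prox}_{(\beta/\mu_n)h^*}\bigl(v_n+(\beta/\mu_n)A(2u_{n+1}-u_n)\bigr),\qquad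 n=0,1,2,\ldots$$ converges to a minimizer of $F_{\lambda,\mu}$.
   Context: For a proper convex closed function $F$ on $\mathbb{R}^m$, the proximal operator is $\operatorname{prox}_F(a)=\arg\min_{u\in\mathbb{R}^m}\frac12\|u-a\|_2^2+F(u)$, where $\|\cdot\|_2$ is the Euclidean norm. The Legendre–Fenchel conjugate is $h^*(\xi)=\sup_{u}\langle\xi,u\rangle-h(u)$. $\partial$ denotes the convex subdifferential, and $\|A\|$ is the spectral norm (largest singular value) of $A$. *)

(* Defs.v *)
From HB Require Import structures.
From mathcomp Require Export all_boot all_order all_algebra.
From mathcomp Require Export all_classical all_reals all_analysis.
Export numFieldNormedType.Exports.

Set Implicit Arguments.
Unset Strict Implicit.
Unset Printing Implicit Defensive.

Import Order.TTheory GRing.Theory Num.Theory.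

Local Open Scope classical_set_scope.
Local Open Scope ring_scope.

(* The library norm on matrices is the sup norm: all metric quantities in the
   statement use the Euclidean norm [enorm] instead.  The two norms induce the
   same topology, so convergence, closedness and differentiability are the
   library's. *)
Definition dot (R : realType) (m : nat) (x y : 'cV[R]_m) : R :=
  \sum_(i < m) x i 0 * y i 0.

Definition enorm (R : realType) (m : nat) (x : 'cV[R]_m) : R :=
  Num.sqrt (dot x x).

Definition singular_values (R : realType) (p m : nat) (A : 'M[R]_(p, m)) :
    set R :=
  [set s : R | 0 <= s /\ eigenvalue (A^T *m A) (s ^+ 2)].

(* [singular_values A] is finite, and nonempty when 0 < m: this supremum is a
   maximum. *)
Definition spectral_norm (R : realType) (p m : nat) (A : 'M[R]_(p, m)) : R :=
  sup (singular_values A).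

Definition gradient (R : realType) (m : nat) (f : 'cV[R]_m -> R)
    (x : 'cV[R]_m) : 'cV[R]_m :=
  \col_i ('D_(delta_mx i 0) f x : R).

Section extended_functions.
Local Open Scope ereal_scope.

Definition argmin (R : realType) (T : Type) (F : T -> \bar R) : set T :=
  [set u | forall w, F u <= F w].

Definition proper_fun (R : realType) (m : nat) (F : 'cV[R]_m -> \bar R) :
    Prop :=
  (forall x, F x != -oo) /\ (exists x, F x < +oo).

(* For t = 0 or 1 the right-hand side relies on the convention 0 * +oo = 0. *)
Definition convex_efun (R : realType) (m : nat) (F : 'cV[R]_m -> \bar R) :
    Prop :=
  forall (x y : 'cV[R]_m) (t : R), (0 <= t <= 1)%R ->
    F (t *: x + (1 - t) *: y)%R <= t%:E * F x + (1 - t)%:E * F y.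

(* closed epigraph *)
Definition closed_efun (R : realType) (m : nat) (F : 'cV[R]_m -> \bar R) :
    Prop :=
  closed [set p : 'cV[R]_m * R | F p.1 <= p.2%:E].

Definition proper_convex_closed (R : realType) (m : nat)
    (F : 'cV[R]_m -> \bar R) : Prop :=
  [/\ proper_fun F, convex_efun F & closed_efun F].

Definition subdifferential (R : realType) (m : nat) (F : 'cV[R]_m -> \bar R)
    (u : 'cV[R]_m) : set 'cV[R]_m :=
  [set xi | forall w : 'cV[R]_m, F u + (dot xi (w - u))%:E <= F w].

Definition conjugate (R : realType) (m : nat) (h : 'cV[R]_m -> \bar R)
    (xi : 'cV[R]_m) : \bar R :=
  ereal_sup [set (dot xi u)%:E - h u | u in setT].

(* The argmin is a singleton when F is proper, convex and closed; the default
   value 0 is only used when the argmin is empty. *)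
Definition prox (R : realType) (m : nat) (F : 'cV[R]_m -> \bar R)
    (a : 'cV[R]_m) : 'cV[R]_m :=
  xget 0%R (argmin (fun u : 'cV[R]_m => (2^-1 * enorm (u - a) ^+ 2)%:E + F u)).

Definition objective (R : realType) (d d' : nat) (f : 'cV[R]_d -> R)
    (g : 'cV[R]_d -> \bar R) (h : 'cV[R]_d' -> \bar R) (A : 'M[R]_(d', d))
    (lambda mu : R) (u : 'cV[R]_d) : \bar R :=
  (f u)%:E + lambda%:E * g u + mu%:E * h (A *m u).

End extended_functions.

(* Main.v *)
Require Import Defs.
From HB Require Import structures.
From mathcomp Require Import all_boot all_order all_algebra.
From mathcomp Require Import all_classical all_reals all_analysis.
From mathcomp Require Import ring lra.
Import Order.TTheory GRing.Theory Num.Theory.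
Import numFieldNormedType.Exports.
Local Open Scope classical_set_scope.
Local Open Scope ring_scope.

(** The iteration is a preconditioned proximal point method whose parameters
    [lambda_ n], [mu_ n] drift to [lambda], [mu] with summable errors, and the
    proof is a quasi-Fejer argument that works directly with the drifting
    parameters.

    By first-order optimality and the sum rule, the minimizer comes with a dual
    point that forms with it a [saddle] of the limit problem
    ([saddle_exists]), and conversely the primal part of a saddle is a
    minimizer ([saddle_argmin]).  Both proximal steps are inclusions between
    iterates and subdifferentials of [g] and [h] ([prox_subgradient],
    [prox_conjugate_subgradient]); for the dual step, Moreau's decomposition
    turns the proximal point of the conjugate into a subgradient of [h].

    For a saddle [(x, y)], consider the energy
    [alpha^-1 |a|^2 - 2 m <A a, b> + m^2 / beta |b|^2] at [a = u n - x],
    [b = v n - y], [m = mu_ n].  Monotonicity of the subdifferentials and the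
    smoothness of [f], in the form of [gradient_three_point], show that a step
    decreases it by the energy of the step minus [L / 2 |u n.+1 - u n|^2], up
    to a perturbation proportional to the parameter error ([energy_step]).
    The step size condition makes this decrease at least a multiple of the
    squared step ([energy_coercive], [spectral_norm_bound]), and replacing
    [mu_ n] by [mu_ n.+1] costs a relative error proportional to
    [`|mu_ n.+1 - mu_ n|] ([energy_change]).  All errors are summable, so the
    energy converges and the steps tend to [0] ([quasi_decreasing_cvg],
    [dist_energy_cvg]).

    Hence the iterates are bounded, and a cluster point is again a saddle since
    subdifferentials have closed graphs ([cluster_saddle]).  The energy
    relative to this particular saddle converges, and it tends to [0] along a
    subsequence, hence altogether: the iterates converge to it
    ([iterates_cvg_saddle]). *)

Set Implicit Arguments.
Unset Strict Implicit.
Unset Printing Implicit Defensive.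

(** * The Euclidean inner product *)

Section dot_theory.
Variables (R : realType) (m : nat).
Implicit Types (x y z : 'cV[R]_m) (a : R).

Lemma dotC x y : dot x y = dot y x.
Proof. by apply: eq_bigr => i _; rewrite mulrC. Qed.

Lemma dotDl x y z : dot (x + y) z = dot x z + dot y z.
Proof. by rewrite -big_split; apply: eq_bigr => i _; rewrite mxE mulrDl. Qed.

Lemma dotZl a x y : dot (a *: x) y = a * dot x y.
Proof. by rewrite /dot mulr_sumr; apply: eq_bigr => i _; rewrite mxE mulrA. Qed.

Lemma dotNl x y : dot (- x) y = - dot x y.
Proof. by rewrite -scaleN1r dotZl mulN1r. Qed.

Lemma dotDr x y z : dot x (y + z) = dot x y + dot x z.
Proof. by rewrite dotC dotDl !(dotC x). Qed.

Lemma dotZr a x y : dot x (a *: y) = a * dot x y.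
Proof. by rewrite dotC dotZl dotC. Qed.

Lemma dotNr x y : dot x (- y) = - dot x y.
Proof. by rewrite dotC dotNl dotC. Qed.

Definition dotE := (dotDl, dotDr, dotNl, dotNr, dotZl, dotZr).

Lemma dot0l y : dot 0 y = 0.
Proof. by rewrite -(scale0r 0) dotZl mul0r. Qed.

Lemma dot_ge0 x : 0 <= dot x x.
Proof. by apply: sumr_ge0 => i _; rewrite -expr2 sqr_ge0. Qed.

Lemma dot_coord x i : x i 0 ^+ 2 <= dot x x.
Proof.
rewrite /dot (bigD1 i)//= -expr2 lerDl.
by apply: sumr_ge0 => j _; rewrite -expr2 sqr_ge0.
Qed.

Lemma dot_eq0 x : dot x x = 0 -> x = 0.
Proof.
move=> x0; apply/colP => i; rewrite mxE; apply/eqP.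
by rewrite -sqrf_eq0 eq_le sqr_ge0 andbT -x0 dot_coord.
Qed.

Lemma enorm_ge0 x : 0 <= enorm x.
Proof. exact: sqrtr_ge0. Qed.

Lemma enorm_sqr x : enorm x ^+ 2 = dot x x.
Proof. by rewrite sqr_sqrtr// dot_ge0. Qed.

Lemma enormZ a x : 0 <= a -> enorm (a *: x) = a * enorm x.
Proof.
move=> a0; rewrite /enorm dotZl dotZr mulrA -expr2 sqrtrM ?sqr_ge0//.
by rewrite sqrtr_sqr ger0_norm.
Qed.

Lemma enormN x : enorm (- x) = enorm x.
Proof. by rewrite /enorm dotNl dotNr opprK. Qed.

Lemma cauchy_schwarz x y : dot x y ^+ 2 <= dot x x * dot y y.
Proof.
have [y0|y0] := eqVneq (dot y y) 0.
  by rewrite (dot_eq0 y0) dotC !dot0l expr0n mulr0.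
have ygt0 : 0 < dot y y by rewrite lt_def y0 dot_ge0.
have : 0 <= dot y y * (dot x x * dot y y - dot x y ^+ 2).
  apply: le_trans (dot_ge0 (dot y y *: x - dot x y *: y)) _.
  by rewrite !dotE (dotC y x) le_eqVlt; apply/orP; left; apply/eqP; ring.
by rewrite pmulr_rge0// subr_ge0.
Qed.

Lemma dot_le_enorm x y : dot x y <= enorm x * enorm y.
Proof.
apply: (le_trans (ler_norm _)); rewrite -sqrtrM ?dot_ge0// -sqrtr_sqr.
exact/ler_wsqrtr/cauchy_schwarz.
Qed.

Lemma ler_normM_dot x y : 2 * `|dot x y| <= dot x x + dot y y.
Proof.
have := dot_ge0 (x - y); have := dot_ge0 (x + y); rewrite !dotE (dotC y x).
by case: (ler0P (dot x y)) => _; lra.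
Qed.

Lemma dotD_le x y : dot (x + y) (x + y) <= 2 * dot x x + 2 * dot y y.
Proof. by have := dot_ge0 (x - y); rewrite !dotE (dotC y x); lra. Qed.

Lemma dotB_sym x y : dot (x - y) (x - y) = dot (y - x) (y - x).
Proof. by rewrite -opprB dotNl dotNr opprK. Qed.

End dot_theory.

Lemma dot_mulmx (R : realType) (p m : nat) (A : 'M[R]_(p, m)) x y :
  dot (A *m x) y = dot x (A^T *m y).
Proof.
rewrite /dot; under eq_bigr do rewrite mxE mulr_suml.
rewrite exchange_big/=; apply: eq_bigr => j _.
by rewrite mxE mulr_sumr; apply: eq_bigr => i _; rewrite mxE mulrAC mulrC mulrA.
Qed.

(** * Convergence and compactness of column vectors *)

Section convergence.
Variable (R : realType).

Lemma cvg_cV (T : Type) (F : set_system T) (FF : Filter F) (m : nat)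
    (x : T -> 'cV[R]_m) (l : 'cV[R]_m) :
  (forall i, x t i 0 @[t --> F] --> l i 0) -> x t @[t --> F] --> l.
Proof.
move=> xl; apply/cvgrPdist_lt => e e0.
have : \forall t \near F, forall i, `|l i 0 - x t i 0| < e.
  apply: filter_forall => i; have /cvgrPdist_lt := xl i; exact.
apply: filterS => t xt; rewrite /Num.norm/= mx_normrE.
apply/bigmax_ltP; split => //= -[i j] _ /=; rewrite !mxE (ord1 j); exact: xt.
Qed.

Lemma cvg_coord (T : Type) (F : set_system T) (FF : Filter F) (m : nat)
    (x : T -> 'cV[R]_m) (l : 'cV[R]_m) i :
  x t @[t --> F] --> l -> x t i 0 @[t --> F] --> l i 0.
Proof. exact: (continuous_cvg _ (@coord_continuous R m 1 i 0 l)). Qed.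

Lemma cvg_dot (T : Type) (F : set_system T) (FF : Filter F) (m : nat)
    (x y : T -> 'cV[R]_m) (l k : 'cV[R]_m) :
  x t @[t --> F] --> l -> y t @[t --> F] --> k ->
  dot (x t) (y t) @[t --> F] --> dot l k.
Proof.
move=> xl yk; rewrite /dot.
apply: cvg_big; [exact: add_continuous|] => i _.
by apply: cvgM; exact: cvg_coord.
Qed.

Lemma cvg_mulmx (T : Type) (F : set_system T) (FF : Filter F) (p m : nat)
    (A : 'M[R]_(p, m)) (x : T -> 'cV[R]_m) (l : 'cV[R]_m) :
  x t @[t --> F] --> l -> A *m x t @[t --> F] --> A *m l.
Proof.
move=> xl; apply: cvg_cV => i; rewrite mxE; under eq_fun do rewrite mxE.
apply: cvg_big; [exact: add_continuous|] => j _.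
by apply: cvgM; [exact: cvg_cst|exact: cvg_coord].
Qed.

(** The Euclidean norm induces the product topology: it dominates every
    coordinate. *)
Lemma cvg_dot0 (T : Type) (F : set_system T) (FF : Filter F) (m : nat)
    (x : T -> 'cV[R]_m) (l : 'cV[R]_m) :
  dot (x t - l) (x t - l) @[t --> F] --> (0 : R) -> x t @[t --> F] --> l.
Proof.
move=> xl; apply: cvg_cV => i; apply/cvgrPdist_lt => e e0.
have /cvgr0Pnorm_lt/(_ _ (exprn_gt0 2 e0)) := xl.
apply: filterS => t; rewrite ger0_norm ?dot_ge0// => xt.
rewrite -(ltr_pXn2r (n := 2)) ?nnegrE// ?(ltW e0)//.
apply: le_lt_trans xt; rewrite real_normK ?num_real//.
by rewrite dotB_sym; apply: le_trans (dot_coord _ i); rewrite !mxE.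
Qed.

Lemma compact_dot_le (m : nat) (M : R) :
  compact [set x : 'cV[R]_m | dot x x <= M].
Proof.
pose K : set 'rV[R]_m := [set v | forall i, v ord0 i \in `[- (M + 1), M + 1]].
have cK : compact K.
  apply: (@rV_compact _ _ (fun=> `[- (M + 1), M + 1]%classic)) => _.
  exact: segment_compact.
have tr_cont : continuous (fun v : 'rV[R]_m => v^T : 'cV[R]_m).
  move=> v; have := @cvg_cV _ (nbhs v) _ m (fun w : 'rV[R]_m => w^T) v^T; apply => i.
  rewrite mxE; under eq_fun do rewrite mxE.
  exact: coord_continuous.
apply: (subclosed_compact (B := (fun v : 'rV[R]_m => v^T) @` K)).
- rewrite -[X in closed X]/((fun x : 'cV[R]_m => dot x x) @^-1` [set r | r <= M]).
  apply: preimage_closed => [x _|]; first exact: (@cvg_dot _ (nbhs x) _ m id id).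
  exact: closed_le.
- apply: continuous_compact => //; exact: continuous_subspaceT.
- move=> x /= xM; exists x^T; last by rewrite trmxK.
  move=> i; rewrite in_itv/= mxE -ler_norml.
  have := le_trans (dot_coord x i) xM; rewrite -real_normK ?num_real//.
  by have := normr_ge0 (x i 0); nra.
Qed.

Lemma bounded_subsequence (m : nat) (x : nat -> 'cV[R]_m) (M : R) :
  (forall n, dot (x n) (x n) <= M) ->
  exists2 s : nat -> nat, s n @[n --> \oo] --> \oo &
  exists l : 'cV[R]_m, x (s n) @[n --> \oo] --> l.
Proof.
move=> xM; have [|l [_ clu]] := @compact_dot_le m M (x @ \oo) _.
  by exists 0%N => // n _ /=; exact: xM.
have near_l n : exists k, (n <= k)%N /\ ball l n.+1%:R^-1 (x k).
  have [||_ [[k nk <-] lk]] := clu (x @` [set k | (n <= k)%N]) (ball l n.+1%:R^-1).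
  - by exists n => // k /= nk; exists k.
  - by apply: nbhsx_ballx; rewrite invr_gt0.
  - by exists k.
have [s s_near] := choice near_l.
exists s.
  by move=> P [N _ NP]; exists N => // n /= Nn; apply: NP;
    exact: leq_trans Nn (s_near n).1.
exists l; apply/cvg_ballP => e e0; near=> n.
apply: le_ball (s_near n).2; apply: ltW; near: n.
exact: (near_infty_natSinv_lt (PosNum e0)).
Unshelve. all: by end_near. Qed.


End convergence.

(** * The spectral norm bounds the operator *)

Lemma quadratic_ge0_linear0 (R : realType) (b q : R) :
  (forall t, 0 <= 2 * t * b + t ^+ 2 * q) -> b = 0.
Proof.
move=> h; have q0 : 0 <= q by have := h 1; have := h (-1); lra.
(* The minimizer is [- b / q]; the shift by [1] avoids dividing by [0]. *)
have /= := h (- b / (1 + q)).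
have -> : 2 * (- b / (1 + q)) * b + (- b / (1 + q)) ^+ 2 * q =
          - (b ^+ 2 * ((2 + q) / (1 + q) ^+ 2)) by field; lra.
rewrite oppr_ge0 pmulr_lle0; last by rewrite divr_gt0 ?exprn_gt0//; lra.
by move=> b0; apply/eqP; rewrite -sqrf_eq0 eq_le b0 sqr_ge0.
Qed.

(** The maximum of [dot (A *m x) (A *m x)] over the unit sphere is attained
    by compactness; since the quadratic form
    [M * dot x x - dot (A *m x) (A *m x)] is nonnegative and vanishes at the
    maximizer, the maximizer is in its kernel, so [M] is an eigenvalue of
    [A^T *m A] and its square root is a singular value. *)
Lemma spectral_norm_bound (R : realType) (p m : nat) (A : 'M[R]_(p, m)) x :
  dot (A *m x) (A *m x) <= spectral_norm A ^+ 2 * dot x x.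
Proof.
case: m A x => [A x|m A x].
  by rewrite (flatmx0 x) mulmx0 !dot0l mulr0.
pose S := [set x : 'cV[R]_m.+1 | dot x x = 1].
have dot_cont : continuous (fun x : 'cV[R]_m.+1 => dot x x).
  by move=> y; exact: (@cvg_dot _ _ (nbhs y) _ _ id id).
have cS : compact S.
  apply: (subclosed_compact _ (@compact_dot_le R m.+1 1)) => [|y /= -> //].
  rewrite -[X in closed X]/((fun x : 'cV[R]_m.+1 => dot x x) @^-1` [set 1]).
  by apply: preimage_closed => [y _|]; [exact: dot_cont|exact: closed_eq].
have S0 : S !=set0.
  exists (delta_mx 0 0); rewrite /S/= /dot (bigD1 (0 : 'I_m.+1))//= big1 => [|i i0].
    by rewrite !mxE !eqxx mulr1 addr0.
  by rewrite !mxE (negbTE i0) mul0r.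
have cA : {within S, continuous (fun x => dot (A *m x) (A *m x))}.
  apply: continuous_subspaceT => y.
  by apply: (@cvg_dot _ _ (nbhs y) _ _ (mulmx A) (mulmx A));
     apply: (@cvg_mulmx _ _ (nbhs y) _ _ _ A id).
have [c /[!inE] c1 cmax] := compact_EVT_max S0 cS cA.
set M := dot (A *m c) (A *m c) in cmax.
have AM y : dot (A *m y) (A *m y) <= M * dot y y.
  have [y0|y0] := eqVneq (dot y y) 0.
    by rewrite (dot_eq0 y0) mulmx0 !dot0l mulr0.
  have ygt0 : 0 < dot y y by rewrite lt_def y0 dot_ge0.
  have e0 : enorm y != 0 by rewrite gt_eqF// sqrtr_gt0.
  have := cmax ((enorm y)^-1 *: y); rewrite inE /S/= -scalemxAr !dotE.
  rewrite !mulrA -!expr2 exprVn enorm_sqr mulVf// => /(_ erefl).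
  by rewrite mulrC ler_pdivrMr.
have M0 : 0 <= M := dot_ge0 _.
have ker y : M * dot c y = dot (A *m c) (A *m y).
  apply/eqP; rewrite -subr_eq0; apply/eqP.
  apply: (@quadratic_ge0_linear0 _ _ (M * dot y y - dot (A *m y) (A *m y))) => t.
  have := AM (c + t *: y); rewrite mulmxDr -scalemxAr !dotE -/M c1.
  by rewrite (dotC y c) (dotC (A *m y) (A *m c)); lra.
pose w := M *: c - A^T *m (A *m c).
have w0 : w = 0.
  apply: dot_eq0; rewrite {1}/w !(dotDl, dotNl, dotZl) ker.
  by rewrite (dotC (A^T *m _)) -dot_mulmx (dotC (A *m w)) subrr.
have sv : singular_values A (Num.sqrt M).
  split; first exact: sqrtr_ge0.
  rewrite sqr_sqrtr//; apply/eigenvalueP; exists c^T.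
    apply: trmx_inj; rewrite trmx_mul trmxK trmx_mul trmxK linearZ/= trmxK.
    by rewrite -mulmxA; apply/eqP; rewrite -subr_eq0 -opprB oppr_eq0 -/w w0.
  rewrite -trmx_eq0 trmxK; apply: contra_eqN c1 => /eqP ->.
  by rewrite dot0l eq_sym oner_eq0.
have ub : ubound (singular_values A) (Num.sqrt M).
  move=> s [s0 /eigenvalueP[v vA v0]].
  have := AM v^T; have -> : dot (A *m v^T) (A *m v^T) = s ^+ 2 * dot v^T v^T.
    have := congr1 trmx vA; rewrite !trmx_mul trmxK linearZ/= -mulmxA.
    by rewrite dot_mulmx => ->; rewrite dotZr.
  rewrite ler_pM2r; first by move=> ?; rewrite -(ger0_norm s0) -sqrtr_sqr ler_wsqrtr.
  rewrite lt_def dot_ge0 andbT; apply: contra v0 => /eqP/dot_eq0 v0.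
  by rewrite -trmx_eq0 v0.
have Msup : Num.sqrt M <= spectral_norm A.
  apply: (@sup_upper_bound R (singular_values A)) => //.
  by split; exists (Num.sqrt M).
apply: le_trans (AM x) _; apply: ler_wpM2r; first exact: dot_ge0.
rewrite -[leLHS]sqr_sqrtr// ler_sqr ?nnegrE ?sqrtr_ge0//.
by apply: le_trans Msup; exact: sqrtr_ge0.
Qed.

(** * Smooth convex functions *)

Section smooth.
Variables (R : realType) (d : nat) (f : 'cV[R]_d -> R).
Hypothesis f_diff : forall x : 'cV[R]_d, differentiable f x.

Lemma derive_gradient (x v : 'cV[R]_d) : 'D_v f x = dot (gradient f x) v.
Proof.
rewrite deriveE//.
have {1}-> : v = \sum_i v i 0 *: delta_mx i 0.
  rewrite {1}(matrix_sum_delta v); apply: eq_bigr => i _.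
  by rewrite big_ord1.
rewrite linear_sum; apply: eq_bigr => i _.
by rewrite linearZ/= -deriveE// mxE mulrC.
Qed.

Lemma is_derive_line (x v : 'cV[R]_d) (t : R) :
  is_derive t (1 : R) (fun s : R => f (x + s *: v))
    (dot (gradient f (x + t *: v)) v).
Proof.
have e : (fun h : R => h^-1 *: ((fun s : R => f (x + s *: v)) (h *: 1 + t) -
            (fun s : R => f (x + s *: v)) t)) =
         (fun h : R => h^-1 *: (f (h *: v + (x + t *: v)) - f (x + t *: v))).
  apply/funext => h; congr (_ *: (f _ - _)).
  by rewrite [h *: 1]mulr1 scalerDl addrCA.
split.
  by rewrite /derivable e; exact: (@diff_derivable _ _ _ f (x + t *: v) v).
by rewrite -derive_gradient /derive /= e.
Qed.

(** Subtracting [s / 2 * t ^+ 2] before applying the mean value theorem turns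
    a linear bound on the variation of the gradient into a quadratic bound with
    the factor [1 / 2]; both signs of [s] are used. *)
Lemma mvt_line (x v : 'cV[R]_d) (s : R) : exists2 c, 0 < c < 1 &
  f (x + v) - f x - s / 2 = dot (gradient f (x + c *: v)) v - s * c.
Proof.
pose phi (t : R) := f (x + t *: v) - s / 2 * t ^+ 2.
have dphi (t : R) : is_derive t (1 : R) phi (dot (gradient f (x + t *: v)) v - s * t).
  have := is_derive_line x v t => dl.
  apply: is_derive_eq.
  by rewrite /GRing.scale/= !mulr1; lra.
have [|c c01 ec] := @MVT R phi (fun t => dot (gradient f (x + t *: v)) v - s * t)
  0 1 ltr01 (fun t _ => dphi t) _.
  apply: continuous_subspaceT => t; apply: differentiable_continuous.
  by apply/derivable1_diffP; have [] := dphi t.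
exists c; first by rewrite in_itv in c01.
by move: ec; rewrite /phi scale1r scale0r addr0; lra.
Qed.

Variable L : R.
Hypothesis f_lip : forall x y : 'cV[R]_d,
  enorm (gradient f x - gradient f y) <= L * enorm (x - y).

Lemma gradient_line_lip (x v : 'cV[R]_d) (c : R) : 0 <= c ->
  `|dot (gradient f (x + c *: v)) v - dot (gradient f x) v| <= L * dot v v * c.
Proof.
move=> c0; have lipv : enorm (gradient f (x + c *: v) - gradient f x) * enorm v
    <= L * dot v v * c.
  apply: le_trans (ler_wpM2r (enorm_ge0 _) (f_lip _ _)) _.
  by rewrite addrC addKr enormZ// -enorm_sqr; lra.
have := dot_le_enorm (gradient f (x + c *: v) - gradient f x) v.
have := dot_le_enorm (- (gradient f (x + c *: v) - gradient f x)) v.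
by rewrite enormN !dotE ler_norml; lra.
Qed.

Lemma descent (x v : 'cV[R]_d) :
  f (x + v) <= f x + dot (gradient f x) v + L / 2 * dot v v.
Proof.
have [c /andP[/ltW c0 _] e] := mvt_line x v (L * dot v v).
by have := gradient_line_lip x v c0; rewrite ler_norml; lra.
Qed.

Lemma descent_lower (x v : 'cV[R]_d) :
  f x + dot (gradient f x) v - L / 2 * dot v v <= f (x + v).
Proof.
have [c /andP[/ltW c0 _] e] := mvt_line x v (- (L * dot v v)).
by have := gradient_line_lip x v c0; rewrite ler_norml; lra.
Qed.

End smooth.

Lemma le_of_small_slope (R : realType) (a b c : R) :
  (forall t, 0 < t <= 1 -> a <= b + t * c) -> a <= b.
Proof.
move=> h; rewrite leNgt; apply/negP => ba.
have ab0 : 0 < a - b by rewrite subr_gt0.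
have ab1 : 0 < (a - b) + `|c| by rewrite ltr_wpDr.
(* A value of [t] in ]0, 1] for which [t * c] stays below the gap [a - b]. *)
have := h ((a - b) / ((a - b) + `|c|)); rewrite divr_gt0//= ler_pdivrMr// mul1r.
rewrite lerDl normr_ge0 => /(_ isT); apply/negP; rewrite -ltNge -ltrBrDl.
rewrite mulrAC ltr_pdivrMr//; have := ler_norm c; nra.
Qed.

Section smooth_convex.
Variables (R : realType) (d : nat) (f : 'cV[R]_d -> R) (L : R).
Hypothesis f_convex : convex_function (E := 'cV[R]_d) setT f.
Hypothesis f_diff : forall x : 'cV[R]_d, differentiable f x.
Hypothesis f_lip : forall x y : 'cV[R]_d,
  enorm (gradient f x - gradient f y) <= L * enorm (x - y).

Lemma convex_segment (x y : 'cV[R]_d) (t : R) : 0 <= t <= 1 ->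
  f (t *: x + (1 - t) *: y) <= t * f x + (1 - t) * f y.
Proof.
move=> /andP[t0 t1].
have := f_convex (Itv01 t0 t1) (in_setT x) (in_setT y); exact.
Qed.

(** Convexity along the segment from [x] to [y], combined with the quadratic
    lower bound for a step [t *: (y - x)], gives the inequality up to an error
    proportional to [t]. *)
Lemma gradient_le (x y : 'cV[R]_d) : f x + dot (gradient f x) (y - x) <= f y.
Proof.
apply: (@le_of_small_slope _ _ _ (L / 2 * dot (y - x) (y - x))) => t /andP[t0 t1].
have t01 : 0 <= t <= 1 by rewrite (ltW t0).
have := descent_lower f_diff f_lip x (t *: (y - x)).
have -> : x + t *: (y - x) = t *: y + (1 - t) *: x.
  by rewrite scalerBr scalerBl scale1r addrCA.
move=> /le_trans/(_ (convex_segment y x t01)).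
by rewrite !(dotZl, dotZr) => h; rewrite -(ler_pM2l t0); lra.
Qed.

(** Compare the two tangent lower bounds and the two quadratic upper bounds at
    [x + s] and [y - s] with [2 *: s = z - x]: the quadratic terms
    add up to [L * dot s s], that is, [L / 4 * dot (z - x) (z - x)]. *)
Lemma gradient_three_point (x y z : 'cV[R]_d) :
  - (L / 4 * dot (z - x) (z - x)) <=
  dot (gradient f x - gradient f y) (z - y).
Proof.
pose s := 2^-1 *: (z - x).
have := descent f_diff f_lip x s; have := descent f_diff f_lip y (- s).
have := gradient_le x (y - s); have := gradient_le y (x + s).
by rewrite /s !dotE; lra.
Qed.

Lemma gradient_cvg (T : Type) (F : set_system T) (FF : Filter F)
    (x : T -> 'cV[R]_d) (l : 'cV[R]_d) :
  x t @[t --> F] --> l -> gradient f (x t) @[t --> F] --> gradient f l.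
Proof.
move=> xl; apply: cvg_dot0.
have bound t : dot (gradient f (x t) - gradient f l)
    (gradient f (x t) - gradient f l) <= L ^+ 2 * dot (x t - l) (x t - l).
  rewrite -!enorm_sqr -exprMn ler_pXn2r ?nnegrE ?enorm_ge0//.
  exact: le_trans (enorm_ge0 _) (f_lip _ _).
have cvg_up : L ^+ 2 * dot (x t - l) (x t - l) @[t --> F] --> (0 : R).
  have xl0 : x t - l @[t --> F] --> (0 : 'cV[R]_d).
    by rewrite -(subrr l); apply: cvgB => //; exact: cvg_cst.
  rewrite -[X in _ --> X](mulr0 (L ^+ 2)) -(dot0l (0 : 'cV[R]_d)).
  by apply: cvgM; [exact: cvg_cst|exact: cvg_dot].
apply: (squeeze_cvgr _ (cvg_cst 0) cvg_up).
by apply: nearW => t; rewrite dot_ge0 bound.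
Qed.

End smooth_convex.

(** * Subgradients and proximal points *)

Section subgradients.
Variables (R : realType) (m : nat).
Implicit Types (G : 'cV[R]_m -> \bar R) (w x y a p xi : 'cV[R]_m).

Lemma proper_fin_num G y : proper_fun G -> (G y < +oo)%E -> G y \is a fin_num.
Proof. by move=> [Gy _] yoo; rewrite fin_numE Gy lt_eqF. Qed.

Lemma subdifferential_fin_num G w p : proper_fun G ->
  subdifferential G w p -> G w \is a fin_num.
Proof.
move=> Gp; have [_ [y yoo]] := Gp => /(_ y) wy.
apply: proper_fin_num => //; have := le_lt_trans wy yoo.
by case: (G w) => [r||]; rewrite ?ltry ?ltNyr.
Qed.

Lemma subdifferential_monotone G x y p q : proper_fun G ->
  subdifferential G x p -> subdifferential G y q ->
  0 <= dot (p - q) (x - y).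
Proof.
move=> Gp xp yq.
have := xp y; have := yq x.
rewrite -(fineK (subdifferential_fin_num Gp xp)).
rewrite -(fineK (subdifferential_fin_num Gp yq)) -!EFinD !lee_fin.
by rewrite !dotE; lra.
Qed.

(** The subgradient inequality at [w] says that [(x, G w - dot p (w - x))] is
    in the epigraph, so it survives limits in [x] and [p]. *)
Lemma subdifferential_closed (T : Type) (F : set_system T)
    (FF : ProperFilter F) G (x p : T -> 'cV[R]_m) y q :
  proper_fun G -> closed_efun G ->
  x t @[t --> F] --> y -> p t @[t --> F] --> q ->
  (forall t, subdifferential G (x t) (p t)) -> subdifferential G y q.
Proof.
move=> Gp Gc xy pq xp w.
case Gw : (G w) => [r||]; first 1 last.
- by rewrite leey.
- by have [/(_ w)] := Gp; rewrite Gw.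
suff : (G y <= (r - dot q (w - y))%:E)%E.
  rewrite EFinB leeBrDr//.
pose e t := (x t, r - dot (p t) (w - x t)).
apply: (closed_cvg (F := F) (u_ := e) _ Gc _ (y, r - dot q (w - y))).
  apply: nearW => t; rewrite /e /= EFinB leeBrDr//.
  by rewrite -Gw; exact: xp.
have c1 : r - dot (p t) (w - x t) @[t --> F] --> r - dot q (w - y).
  apply: cvgB; first exact: cvg_cst.
  by apply: cvg_dot => //; apply: cvgB => //; exact: cvg_cst.
exact: (cvg_pair xy c1).
Qed.

(** First-order optimality for the sum of a function with a quadratic upper
    model and a convex one: move from the minimizer [w] towards [y] by a step
    [k], divide by [k] and let [k] tend to [0]. *)
Lemma subdifferential_of_min G (phi : 'cV[R]_m -> R) w xi (s C t : R) : 0 < t ->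
  (forall y, G y != -oo%E) -> G w = s%:E ->
  (forall y (r k : R), G y = r%:E -> 0 <= k <= 1 ->
    (G (k *: y + (1 - k) *: w)%R <= (k * r + (1 - k) * s)%:E)%E) ->
  (forall v, phi (w + v) <= phi w + dot xi v + C * dot v v) ->
  (forall y, ((phi w)%:E + t%:E * G w <= (phi y)%:E + t%:E * G y)%E) ->
  subdifferential G w (- (t^-1 *: xi)).
Proof.
move=> t0 GNy Gw Gconv phi_le wmin y.
case Gy : (G y) => [r||]; last 2 first.
- by rewrite leey.
- by have := GNy y; rewrite Gy.
rewrite Gw -EFinD lee_fin.
suff : t * s - dot xi (y - w) <= t * r.
  rewrite -(ler_pM2l t0) => h; apply: le_trans h.
  by rewrite dotNl dotZl mulrDr mulrN mulVKf ?gt_eqF.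
apply: (@le_of_small_slope _ _ _ (C * dot (y - w) (y - w))) => k /andP[k0 k1].
have k01 : 0 <= k <= 1 by rewrite (ltW k0).
have z_eq : w + k *: (y - w) = k *: y + (1 - k) *: w.
  by rewrite scalerBr scalerBl scale1r addrCA.
have := wmin (k *: y + (1 - k) *: w); have := Gconv _ _ _ Gy k01.
have := phi_le (k *: (y - w)); rewrite z_eq Gw.
have := GNy (k *: y + (1 - k) *: w).
case: (G _) => [z||] // _; rewrite !dotE -!EFinM -!EFinD !lee_fin => h1 h2 h3.
rewrite -(ler_pM2l k0); have := ler_wpM2l (ltW t0) h2; lra.
Qed.

(** The subgradient inequality leaves a surplus [2^-1 * dot (y - w) (y - w)] at
    every other point [y], so [w] is the only minimizer. *)
Lemma prox_eq G w s p a (t : R) : 0 < t -> G w = s%:E ->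
  subdifferential G w p -> a = w + t *: p ->
  prox (fun u => t%:E * G u)%E a = w.
Proof.
move=> t0 Gw wp aw.
have key y : ((2^-1 * enorm (w - a) ^+ 2 + t * s + 2^-1 * dot (y - w) (y - w))%:E <=
   (2^-1 * enorm (y - a) ^+ 2)%:E + t%:E * G y)%E.
  have := wp y; rewrite Gw; case: (G y) => [r||]//; last first.
    by move=> _; rewrite gt0_muley ?lte_fin// addey// leey.
  rewrite -EFinD -EFinM -EFinD !lee_fin => h.
  have := ler_wpM2l (ltW t0) h; rewrite !enorm_sqr aw !dotE.
  by rewrite (dotC p w) (dotC p y) (dotC y w); lra.
apply: xget_unique => [y|y].
  rewrite Gw -EFinM -EFinD; apply: le_trans (key y).
  by rewrite lee_fin lerDl mulr_ge0 ?dot_ge0// invr_ge0.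
move=> /(_ w) /(le_trans (key y)); rewrite Gw -EFinM -EFinD lee_fin gerDl.
rewrite pmulr_rle0 ?invr_gt0// => yw; apply/eqP; rewrite -subr_eq0; apply/eqP.
by apply: dot_eq0; apply/eqP; rewrite eq_le yw dot_ge0.
Qed.

(** Minimize [2^-1 * dot (u - a) (u - a) + t * r] over the part of the closed
    epigraph where it is below its value at a point of the graph over [x]; the
    affine minorant given by the subgradient at [x] makes this part bounded. *)
Lemma prox_exists G x p a (t : R) : 0 < t -> proper_fun G -> closed_efun G ->
  subdifferential G x p -> exists w, G w \is a fin_num /\
  argmin (fun u => (2^-1 * enorm (u - a) ^+ 2)%:E + t%:E * G u)%E w.
Proof.
move=> t0 Gp Gc xp.
have Gx := subdifferential_fin_num Gp xp.
pose r0 := fine (G x).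
pose J (u : 'cV[R]_m * R) := 2^-1 * dot (u.1 - a) (u.1 - a) + t * u.2.
pose E := [set u : 'cV[R]_m * R | (G u.1 <= u.2%:E)%E].
pose S := E `&` [set u | J u <= J (x, r0)].
have x_in : S (x, r0) by split => //=; rewrite /E/= fineK.
have J_cont : continuous J.
  move=> u; have c1 : v.1 - a @[v --> u] --> u.1 - a.
    by apply: cvgB; [exact: cvg_fst|exact: cvg_cst].
  apply: cvgD; apply: cvgM; try exact: cvg_cst; last exact: cvg_snd.
  exact: cvg_dot.
have minorant u : E u -> r0 + dot p (u.1 - x) <= u.2.
  by move=> /(le_trans (xp u.1)); rewrite -(fineK Gx) -EFinD lee_fin.
pose c := r0 - dot p x.
pose B := 4 * (J (x, r0) - t * (c + dot p a) + t ^+ 2 * dot p p).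
pose M := 2 * B + 2 * dot a a.
have bnd u : S u -> dot u.1 u.1 <= M /\ c - dot p p - M <= u.2 <= J (x, r0) / t.
  move=> [/minorant + Ju]; rewrite dotDr dotNr => mu.
  have {}mu : t * (c + dot p u.1) <= t * u.2 by rewrite ler_pM2l// /c; lra.
  have uB : dot (u.1 - a) (u.1 - a) <= B.
    have := dot_ge0 (2^-1 *: (u.1 - a) + t *: p).
    by move: Ju mu; rewrite /B /= /J !dotE (dotC _ p) (dotC _ p); lra.
  have uM : dot u.1 u.1 <= M.
    have := dotD_le (u.1 - a) a; rewrite subrK /M; lra.
  split=> //; rewrite ler_pdivlMr// (mulrC _ t); apply/andP; split; last first.
    have := dot_ge0 (u.1 - a); move: Ju; rewrite /= {1}/J; lra.
  have := ler_normM_dot p u.1; have := ler_norm (- dot p u.1); rewrite normrN.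
  have := dot_ge0 p; have := dot_ge0 u.1.
  move: mu; rewrite ler_pM2l//; lra.
have Scpt : compact S.
  apply: (subclosed_compact _ (compact_setX (@compact_dot_le R m M)
    (@segment_compact R (c - dot p p - M) (J (x, r0) / t)))).
    apply: closedI => //.
    rewrite -[X in closed X]/(J @^-1` [set r | r <= J (x, r0)]).
    by apply: preimage_closed => [u _|]; [exact: J_cont|exact: closed_le].
  by move=> u /bnd[u1 u2]; split => //=; rewrite in_itv.
have [[w rho] /[!inE] -[Ew Jw] Jmin] :=
  compact_EVT_min (ex_intro _ _ x_in) Scpt (continuous_subspaceT J_cont).
have Gw : G w \is a fin_num.
  by apply: proper_fin_num => //; apply: le_lt_trans Ew (ltry _).
exists w; split => // y.
case Gy : (G y) => [r||]; last 2 first.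
- by rewrite gt0_muley ?lte_fin// addey// leey.
- by have [/(_ y)] := Gp; rewrite Gy.
have Jwy : J (w, rho) <= J (y, r).
  have [yS|yS] := leP (J (y, r)) (J (x, r0)).
    by apply: Jmin; rewrite inE; split => //; rewrite /E/= Gy.
  exact: le_trans Jw (ltW yS).
move: Ew; rewrite /E/= -(fineK Gw) -!EFinM -!EFinD !lee_fin !enorm_sqr => Ew.
apply: le_trans Jwy; rewrite /J/= lerD2l ler_pM2l//.
Qed.

(** A minimizer exists, it satisfies the inclusion by first-order optimality,
    and [prox_eq] then identifies it with the chosen proximal point. *)
Lemma prox_subgradient G x p a (t : R) : 0 < t -> proper_convex_closed G ->
  subdifferential G x p ->
  subdifferential G (prox (fun u => t%:E * G u)%E a)
    (t^-1 *: (a - prox (fun u => t%:E * G u)%E a)).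
Proof.
move=> t0 [Gp Gv Gc] xp.
have [w [Gw wmin]] := prox_exists a t0 Gp Gc xp.
have wsub : subdifferential G w (t^-1 *: (a - w)).
  rewrite -opprB scalerN.
  apply: (@subdifferential_of_min G (fun u => 2^-1 * enorm (u - a) ^+ 2) w (w - a)
    (fine (G w)) 2^-1 t t0).
  - by case: Gp.
  - by rewrite fineK.
  - move=> y r k Gy k01; apply: le_trans (Gv _ _ _ k01) _.
    by rewrite Gy -[in leLHS](fineK Gw).
  - move=> v; rewrite !enorm_sqr !dotE (dotC v w) (dotC v a) (dotC a w); lra.
  - exact: wmin.
rewrite (@prox_eq G w (fine (G w)) (t^-1 *: (a - w)) a t t0) ?fineK//.
by rewrite scalerA mulfV ?gt_eqF// scale1r addrC subrK.
Qed.

Lemma conjugate_ge G xi p (r : R) : G p = r%:E ->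
  ((dot xi p - r)%:E <= conjugate G xi)%E.
Proof.
by move=> Gp; apply: ereal_sup_ubound; exists p => //; rewrite Gp.
Qed.

(** Equality case of the Fenchel-Young inequality. *)
Lemma conjugate_subdifferential G xi p (r : R) : G p = r%:E ->
  subdifferential G p xi -> conjugate G xi = (dot xi p - r)%:E.
Proof.
move=> Gp pxi; apply/le_anti/andP; split; last exact: conjugate_ge.
apply: ub_ereal_sup => _ [u _ <-]; have := pxi u; rewrite Gp.
case: (G u) => [k||]// ; last by rewrite addeC leNye.
by rewrite -EFinD !lee_fin dotDr dotNr; lra.
Qed.

(** Moreau's decomposition expresses the proximal point of the conjugate by
    that of [G] itself: it is [a - t *: y], where [y] is the proximal point of
    [t^-1 * G] at [t^-1 *: a]. *)
Lemma prox_conjugate_subgradient G x p a (t : R) : 0 < t ->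
  proper_convex_closed G -> subdifferential G x p ->
  subdifferential G (t^-1 *: (a - prox (fun u => t%:E * conjugate G u)%E a))
    (prox (fun u => t%:E * conjugate G u)%E a).
Proof.
move=> t0 Gpcc xp; have [Gp _ _] := Gpcc.
have ti0 : 0 < t^-1 by rewrite invr_gt0.
have := prox_subgradient (t^-1 *: a) ti0 Gpcc xp.
set y := prox _ _; rewrite invrK scalerBr scalerA mulfV ?gt_eqF// scale1r => ysub.
have Gy := subdifferential_fin_num Gp ysub.
set w := a - t *: y in ysub.
have -> : prox (fun u => t%:E * conjugate G u)%E a = w.
  apply: (@prox_eq _ w (dot w y - fine (G y)) y a t t0).
  - by apply: conjugate_subdifferential; rewrite ?fineK.
  - move=> xi; rewrite (@conjugate_subdifferential _ w y (fine (G y))) ?fineK//.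
    apply: le_trans (@conjugate_ge _ xi y (fine (G y)) _); rewrite ?fineK//.
    by rewrite -EFinD lee_fin (dotC y) dotDl dotNl; lra.
  - by rewrite subrK.
by rewrite /w opprB addrC subrK scalerA mulVf ?gt_eqF// scale1r.
Qed.

End subgradients.

(** * Summable errors *)

Section summable_errors.
Variable R : realType.

Lemma nneseries_partial_bound (e : nat -> R) : (forall n, 0 <= e n) ->
  (\sum_(0 <= n <oo) (e n)%:E < +oo)%E ->
  exists B, forall n, \sum_(0 <= k < n) e k <= B.
Proof.
move=> e0 efin; exists (fine (\sum_(0 <= n <oo) (e n)%:E)) => n.
have S0 : (0 <= \sum_(0 <= n <oo) (e n)%:E)%E.
  by apply: nneseries_ge0 => k _ _; rewrite lee_fin.
rewrite -lee_fin fineK ?ge0_fin_numE// -sumEFin.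
by apply: nneseries_lim_ge => k _ _; rewrite lee_fin.
Qed.

Lemma partial_bound_cvg (e : nat -> R) (B : R) : (forall n, 0 <= e n) ->
  (forall n, \sum_(0 <= k < n) e k <= B) -> cvgn (series e).
Proof.
move=> e0 eB; apply: nondecreasing_is_cvgn.
  by apply: nondecreasing_series => n _ _; exact: e0.
by exists B => _ [n _ <-]; exact: eB.
Qed.

(** A nonnegative sequence that decreases up to summable relative and absolute
    errors is bounded, because the product of the factors [expR (a * e k)] is;
    the relative errors are then summable absolute errors, and subtracting their
    partial sums makes the sequence nonincreasing. *)
Lemma quasi_decreasing_cvg (x e delta : nat -> R) (a k B : R) :
  0 <= a -> 0 <= k -> (forall n, 0 <= x n) -> (forall n, 0 <= e n) ->
  (forall n, 0 <= delta n) -> (forall n, \sum_(0 <= i < n) e i <= B) ->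
  (forall n, x n.+1 <= (1 + a * e n) * x n + k * e n - delta n) ->
  cvgn x /\ delta n @[n --> \oo] --> (0 : R).
Proof.
move=> a0 k0 x0 e0 delta0 eB xS.
have xexp n : x n <= expR (a * series e n) * (x 0%N + k * series e n).
  elim: n => [|n IH].
    by rewrite /series/= big_geq// !mulr0 expR0 addr0 mul1r.
  rewrite seriesSr; set s := series e n in IH *.
  apply: (le_trans (xS n)); apply: (@le_trans _ _ (expR (a * e n) * (x n + k * e n))).
    have := expR_ge1Dx (a * e n); have := mulr_ge0 a0 (e0 n) => ae0 exp1.
    have := ler_wpM2r (x0 n) exp1; have := mulr_ge0 k0 (e0 n); have := delta0 n.
    move=> d0 ke0; have := ler_wpM2r ke0 exp1.
    nra.
  rewrite !mulrDr expRD; set E := expR (a * e n); set E' := expR (a * s).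
  have E0 : 0 <= E := expR_ge0 _; have ke0 := mulr_ge0 k0 (e0 n).
  have E'1 : 1 <= E'.
    by apply: le_trans (expR_ge1Dx _); rewrite lerDl mulr_ge0// sumr_ge0.
  have := ler_wpM2l E0 IH; rewrite -/E' => IH'.
  have := ler_wpM2r (mulr_ge0 E0 ke0) E'1; lra.
have sB n : 0 <= series e n <= B by rewrite sumr_ge0//= eB.
pose M := expR (a * B) * (x 0%N + k * B).
have B0 : 0 <= B by have /andP[/le_trans] := sB 0%N; apply.
have xM n : x n <= M.
  apply: le_trans (xexp n) _; have /andP[s0 s1] := sB n.
  apply: ler_pM; rewrite ?expR_ge0 ?addr_ge0 ?mulr_ge0//.
    by rewrite ler_expR ler_wpM2l.
  by rewrite lerD2l ler_wpM2l.
pose T := a * M + k.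
have T0 : 0 <= T by rewrite addr_ge0// mulr_ge0// (le_trans _ (xM 0%N)).
pose y n := x n - T * series e n.
have yS n : delta n <= y n - y n.+1.
  have := ler_wpM2l (mulr_ge0 a0 (e0 n)) (xM n); have := xS n.
  rewrite /y seriesSr /T; lra.
have cy : cvgn y.
  apply: nonincreasing_is_cvgn.
    by apply/nonincreasing_seqP => n; have := delta0 n; have := yS n; lra.
  exists (- (T * B)) => _ [n _ <-]; have /andP[_] := sB n => /(ler_wpM2l T0).
  by rewrite /y; have := x0 n; lra.
split.
  have -> : x = y + (fun n => T * series e n).
    by apply/funext => n; rewrite /y fctE subrK.
  apply: is_cvgD => //; apply: is_cvgMr.
  exact: partial_bound_cvg eB.
have y0 : y n - y n.+1 @[n --> \oo] --> (0 : R).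
  rewrite -(subrr (limn y)); apply: cvgB => //.
  by rewrite (cvg_shiftS y).
apply: (squeeze_cvgr _ (cvg_cst 0) y0).
by apply: nearW => n; rewrite delta0 yS.
Qed.

(** The inverses converge, hence are bounded. *)
Lemma cvg_pos_lbound (e : nat -> R) (l : R) : (forall n, 0 < e n) -> 0 < l ->
  e n @[n --> \oo] --> l -> exists2 c, 0 < c & forall n, c <= e n.
Proof.
move=> e0 l0 el.
have : cvgn (fun n => (e n)^-1).
  by apply/cvg_ex; exists l^-1; apply: cvgV => //; rewrite gt_eqF.
move=> /cvg_seq_bounded/ex_strict_bound_gt0[M M0 eM].
exists M^-1; rewrite ?invr_gt0// => n.
have /= := eM n I; rewrite gtr0_norm ?invr_gt0// => /ltW.
by rewrite -(lef_pV2 (x := M)) ?posrE ?invr_gt0// invrK.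
Qed.

End summable_errors.

(** * The primal-dual energy *)

Section energy.
Variables (R : realType) (d d' : nat) (A : 'M[R]_(d', d)) (alpha beta : R).
Hypothesis beta_gt0 : 0 < beta.

(** The squared norm of [(a, m *: b)] in the metric of preconditioned
    primal-dual splitting. *)
Definition energy (m : R) (a : 'cV[R]_d) (b : 'cV[R]_d') : R :=
  alpha^-1 * dot a a - 2 * m * dot (A *m a) b + m ^+ 2 / beta * dot b b.

Variable K : R.
Hypothesis AK : forall x, dot (A *m x) (A *m x) <= K * dot x x.
Hypothesis K_ge0 : 0 <= K.

(** Young's inequality with a weight [tau] slightly larger than [beta] absorbs
    the cross term in the two squares and leaves a positive remainder of
    each. *)
Lemma energy_coercive (L m0 : R) : 0 < m0 -> beta * K < alpha^-1 - L / 2 ->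
  exists2 c, 0 < c & forall m a b, m0 <= m ->
  c * (dot a a + dot b b) <= energy m a b - L / 2 * dot a a.
Proof.
move=> m00; set kappa := alpha^-1 - L / 2 => betaK.
(* Chosen so that [beta < tau] while still [tau * K < kappa]. *)
pose eps := (kappa - beta * K) / (2 * (K + 1)).
have K1 : 0 < K + 1 by rewrite ltr_wpDl.
have eps0 : 0 < eps by rewrite divr_gt0 ?subr_gt0// mulr_gt0.
have epsE : eps * (K + 1) = (kappa - beta * K) / 2.
  by rewrite /eps invfM mulrA -mulrA mulVf ?gt_eqF// mulr1.
pose tau := beta + eps.
have tau0 : 0 < tau by rewrite addr_gt0.
have c1 : 0 < kappa - tau * K.
  by have := mulr_ge0 (ltW eps0) K_ge0; rewrite /tau; lra.
have c2 : 0 < beta^-1 - tau^-1.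
  by rewrite subr_gt0 ltf_pV2 ?posrE// ltrDl.
pose c := Num.min (kappa - tau * K) (m0 ^+ 2 * (beta^-1 - tau^-1)).
have c0 : 0 < c by rewrite lt_min c1/= mulr_gt0// exprn_gt0.
exists c => // m a b m0m.
have young : 2 * m * dot (A *m a) b <= tau * dot (A *m a) (A *m a) + m ^+ 2 / tau * dot b b.
  rewrite -(ler_pM2l tau0).
  have -> : tau * (tau * dot (A *m a) (A *m a) + m ^+ 2 / tau * dot b b) =
     tau ^+ 2 * dot (A *m a) (A *m a) + m ^+ 2 * dot b b by field; rewrite gt_eqF.
  have := dot_ge0 (tau *: (A *m a) - m *: b); rewrite !dotE (dotC b (A *m a)); lra.
have h1 := ler_wpM2l (ltW tau0) (AK a).
have h2 : c * dot a a <= (kappa - tau * K) * dot a a.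
  by rewrite ler_wpM2r ?dot_ge0// ge_min lexx.
have h3 : c * dot b b <= m ^+ 2 * (beta^-1 - tau^-1) * dot b b.
  rewrite ler_wpM2r ?dot_ge0// ge_min; apply/orP; right.
  rewrite ler_wpM2r ?(ltW c2)// ler_pXn2r ?nnegrE ?(ltW m00)//.
  exact: le_trans (ltW m00) m0m.
rewrite /energy; move: h1 h2 h3 young; rewrite /kappa; lra.
Qed.

Lemma energy_change (m m' M : R) a b : 0 <= m <= M -> 0 <= m' <= M ->
  energy m' a b <= energy m a b +
    (K + 1 + 2 * M / beta) * `|m' - m| * (dot a a + dot b b).
Proof.
move=> /andP[m0 mM] /andP[m'0 m'M]; have n0 := normr_ge0 (m' - m).
have cross : - (2 * (m' - m) * dot (A *m a) b) <= `|m' - m| * (K * dot a a + dot b b).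
  apply: (le_trans (ler_norm _)); rewrite normrN -mulrA mulrCA normrM.
  apply: ler_wpM2l => //; rewrite normrM ger0_norm//.
  by apply: le_trans (ler_normM_dot _ _) _; rewrite lerD2r AK.
have sq : (m' ^+ 2 - m ^+ 2) / beta * dot b b <= 2 * M / beta * `|m' - m| * dot b b.
  rewrite ler_wpM2r ?dot_ge0// mulrAC ler_wpM2r ?invr_ge0 ?(ltW beta_gt0)//.
  rewrite subr_sqr; apply: (le_trans (ler_norm _)); rewrite normrM mulrC.
  by rewrite ler_wpM2r// ger0_norm; lra.
have a0 := dot_ge0 a; have b0 := dot_ge0 b.
have Mb0 : 0 <= 2 * M / beta by rewrite divr_ge0 ?(ltW beta_gt0)//; lra.
have r1 := mulr_ge0 (mulr_ge0 (addr_ge0 ler01 Mb0) n0) a0.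
have r2 := mulr_ge0 (mulr_ge0 K_ge0 n0) b0.
rewrite /energy; move: cross sq r1 r2; lra.
Qed.

Lemma cvg_energy (T : Type) (F : set_system T) (FF : Filter F)
    (m : T -> R) (x : T -> 'cV[R]_d) (y : T -> 'cV[R]_d') (l : R) a b :
  m t @[t --> F] --> l -> x t @[t --> F] --> a -> y t @[t --> F] --> b ->
  energy (m t) (x t) (y t) @[t --> F] --> energy l a b.
Proof.
move=> ml xa yb; apply: cvgD; first apply: cvgB.
- by apply: cvgM; [exact: cvg_cst|exact: cvg_dot].
- apply: cvgM; first by apply: cvgM => //; exact: cvg_cst.
  by apply: cvg_dot => //; exact: cvg_mulmx.
- apply: cvgM; last exact: cvg_dot.
  by apply: cvgM; [exact: cvgM|exact: cvg_cst].
Qed.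

End energy.

(** * Saddle points *)

Section saddle_points.
Variables (R : realType) (d d' : nat) (f : 'cV[R]_d -> R) (L : R)
  (g : 'cV[R]_d -> \bar R) (h : 'cV[R]_d' -> \bar R) (A : 'M[R]_(d', d))
  (lambda mu : R).
Hypothesis f_convex : convex_function (E := 'cV[R]_d) setT f.
Hypothesis f_diff : forall x : 'cV[R]_d, differentiable f x.
Hypothesis f_lip : forall x y : 'cV[R]_d,
  enorm (gradient f x - gradient f y) <= L * enorm (x - y).
Hypotheses (g_pcc : proper_convex_closed g) (h_pcc : proper_convex_closed h).
Hypotheses (lambda_gt0 : 0 < lambda) (mu_gt0 : 0 < mu).

Definition saddle (x : 'cV[R]_d) (y : 'cV[R]_d') : Prop :=
  subdifferential g x (- (lambda^-1 *: (gradient f x + mu *: (A^T *m y)))) /\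
  subdifferential h (A *m x) y.

(** The multiplier [y] cancels in the sum of the three subgradient
    inequalities at [x]. *)
Lemma saddle_argmin x y : saddle x y -> argmin (objective f g h A lambda mu) x.
Proof.
move=> [gx hx] w; rewrite /objective.
have [[gp _ _] [hp _ _]] := (g_pcc, h_pcc).
have := gx w; have := hx (A *m w).
rewrite -(fineK (subdifferential_fin_num gp gx)).
rewrite -(fineK (subdifferential_fin_num hp hx)).
have [[gNy _] [hNy _]] := (gp, hp).
have := gNy w; have := hNy (A *m w).
case: (h (A *m w)) => [s||]//; case: (g w) => [r||]// _ _.
2-4: by move=> _ _; rewrite !gt0_muley ?lte_fin ?addey ?addye ?leey.
rewrite -!EFinM -!EFinD !lee_fin -mulmxBr => hw gw.
have fw := gradient_le f_convex f_diff f_lip x w.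
have := ler_wpM2l (ltW lambda_gt0) gw; have := ler_wpM2l (ltW mu_gt0) hw.
rewrite dotC dot_mulmx dotNl !dotZl dotDl dotZl (dotC (w - x)).
rewrite (mulrDr lambda) mulrN mulVKf ?gt_eqF//; lra.
Qed.

Hypothesis subdiff_sum : forall u : 'cV[R]_d,
  subdifferential (fun w => lambda%:E * g w + mu%:E * h (A *m w))%E u =
  [set lambda *: p + mu *: (A^T *m q) |
     p in subdifferential g u & q in subdifferential h (A *m u)].

(** The gradient of [f] at a minimizer is minus a subgradient of the nonsmooth
    part, which the sum rule splits; its [h]-component is the dual point. *)
Lemma saddle_exists x : argmin (objective f g h A lambda mu) x ->
  (objective f g h A lambda mu x < +oo)%E -> exists y, saddle x y.
Proof.
have [[[gNy _] gconv _] [[hNy _] hconv _]] := (g_pcc, h_pcc).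
pose G w := (lambda%:E * g w + mu%:E * h (A *m w))%E.
have fin w : (G w < +oo)%E -> exists r s, [/\ g w = r%:E, h (A *m w) = s%:E &
    G w = (lambda * r + mu * s)%:E].
  rewrite /G; have := gNy w; have := hNy (A *m w).
  case: (h (A *m w)) => [s||]//; case: (g w) => [r||]// _ _.
  - by exists r, s.
  - by rewrite gt0_muley ?lte_fin// addye.
  - by rewrite gt0_muley ?lte_fin// addey.
  - by rewrite !gt0_muley ?lte_fin.
have GNy w : G w != -oo%E.
  have := gNy w; have := hNy (A *m w); rewrite /G.
  case: (h (A *m w)) => [s||]//; case: (g w) => [r||]// _ _.
  - by rewrite gt0_muley ?lte_fin// addye.
  - by rewrite gt0_muley ?lte_fin// addey.
  - by rewrite !gt0_muley ?lte_fin.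
move=> xmin xfin.
have Gx_lt : (G x < +oo)%E.
  move: xfin; rewrite /objective -addeA -/(G x).
  by case: (G x) => [?||]; rewrite ?ltry ?ltNyr.
have [r [s [gx hx Gx]]] := fin x Gx_lt.
have : subdifferential G x (- (1^-1 *: gradient f x)).
  apply: (@subdifferential_of_min _ _ G f x (gradient f x) _ (L / 2) 1 ltr01 GNy Gx).
  - move=> w q k Gw k01; have [|r' [s' [gw hw]]] := fin w; first by rewrite Gw ltry.
    rewrite Gw => -[->].
    have g_le := gconv _ _ _ k01; have := g_le w x; rewrite gw gx -!EFinM -EFinD => g1.
    have := hconv (A *m w) (A *m x) _ k01; rewrite hw hx -!EFinM -EFinD => h1.
    rewrite /G mulmxDr -!scalemxAr.
    apply: le_trans (leeD (lee_wpmul2l _ g1) (lee_wpmul2l _ h1)) _.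
    + by rewrite lee_fin ltW.
    + by rewrite lee_fin ltW.
    + by rewrite -!EFinM -EFinD lee_fin; lra.
  - by move=> v; exact: (descent f_diff f_lip).
  - by move=> w; have := xmin w; rewrite /objective -!addeA !mul1e.
rewrite subdiff_sum => -[p gp [q hq pq]]; exists q; split => //.
have -> : - (lambda^-1 *: (gradient f x + mu *: (A^T *m q))) = p => //.
rewrite -scalerN opprD -[- gradient f x]scale1r -{1}invr1 scalerN -pq.
by rewrite addrK scalerA mulVf ?gt_eqF// scale1r.
Qed.

Variables (alpha beta : R).
Hypotheses (alpha_gt0 : 0 < alpha) (beta_gt0 : 0 < beta).

(** Add up the monotonicity of the two subdifferentials between the new iterate
    and the saddle point; the skew terms recombine into the cross term of the
    energy, the gradients are handled by the three-point inequality, and the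
    deviation of [l, m] from [lambda, mu] only leaves the last two terms. *)
Lemma energy_step (l m : R) (x x' xh : 'cV[R]_d) (y y' yh : 'cV[R]_d') :
  0 < l -> 0 < m -> saddle xh yh ->
  subdifferential g x' ((alpha * l)^-1 *:
    (x - alpha *: gradient f x - (alpha * m) *: (A^T *m y) - x')) ->
  subdifferential h ((beta / m)^-1 *:
    (y + (beta / m) *: (A *m (2 *: x' - x)) - y')) y' ->
  energy A alpha beta m (x' - xh) (y' - yh) <=
  energy A alpha beta m (x - xh) (y - yh)
  - (energy A alpha beta m (x' - x) (y' - y) - L / 2 * dot (x' - x) (x' - x))
  + 2 * ((l / lambda - 1) * dot (gradient f xh) (x' - xh)
         + (l * mu / lambda - m) * dot (A^T *m yh) (x' - xh)).
Proof.
move=> l0 m0 [gxh hxh] gx' hx'.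
have [[gp _ _] [hp _ _]] := (g_pcc, h_pcc).
have grad := gradient_three_point f_convex f_diff f_lip x xh x'.
pose a := x' - xh; pose p := x - x'; pose b := y' - yh; pose q := y - y'.
have ea : alpha * l != 0 by rewrite mulf_neq0 ?gt_eqF.
have eb : beta / m != 0 by rewrite mulf_neq0 ?invr_neq0 ?gt_eqF.
(* In terms of the new errors [a], [b] and the backward steps [p], [q]. *)
have primal : 0 <= alpha^-1 * dot p a - dot (gradient f x - gradient f xh) a
    - m * dot (A *m a) (b + q) + (l / lambda - 1) * dot (gradient f xh) a
    + (l * mu / lambda - m) * dot (A^T *m yh) a.
  have := ler_wpM2l (ltW l0) (subdifferential_monotone gp gx' gxh).
  rewrite mulr0 -/a; congr (_ <= _).
  rewrite dot_mulmx (dotC a) /b /q (addrC (y' - yh)) addrA subrK.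
  have -> : x - alpha *: gradient f x - (alpha * m) *: (A^T *m y) - x' =
     p - alpha *: gradient f x - (alpha * m) *: (A^T *m y).
    by rewrite /p (addrAC _ _ (- x')) (addrAC x).
  rewrite mulmxBr; clearbody a p; rewrite !dotE; field.
  by rewrite !gt_eqF.
have dual : 0 <= m ^+ 2 / beta * dot q b + m * dot (A *m (a - p)) b.
  have := ler_wpM2l (ltW m0) (subdifferential_monotone hp hx' hxh).
  rewrite mulr0; congr (_ <= _).
  have -> : a - p = (2 *: x' - x) - xh.
    by apply/colP => i; rewrite !mxE; ring.
  have -> : (beta / m)^-1 *: (y + (beta / m) *: (A *m (2 *: x' - x)) - y') =
      (beta / m)^-1 *: q + A *m (2 *: x' - x).
    rewrite [y + _ - y']addrAC -/q scalerDr scalerA mulVf// scale1r //.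
  rewrite (mulmxBr A _ xh) -/b -addrA; set z := A *m _ - _; clearbody q z b.
  rewrite (dotC b) !dotE; field.
  by rewrite !gt_eqF.
have -> : x - xh = a + p by apply/colP => i; rewrite !mxE; ring.
have -> : y - yh = b + q by apply/colP => i; rewrite !mxE; ring.
rewrite -(opprB x x') -(opprB y y') -/a -/b -/p -/q in grad *.
move: primal dual grad; clearbody a b p q.
rewrite /energy !(mulmxDr, mulmxN) !dotE (dotC p a) (dotC q b).
rewrite [dot (gradient f x) a]dotC; lra.
Qed.

End saddle_points.

(** * Convergence of the perturbed iterates *)

(** A linear perturbation at the new point [a + p] splits into a part relative
    to the old point [a] and a part that the squared step [p] absorbs. *)
Lemma perturbation_bound (R : realType) (m : nat) (G a p : 'cV[R]_m) (c w s : R) :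
  0 < c -> `|s| <= w ->
  2 * (s * dot G (a + p)) <= w * (dot G G + dot a a) + c / 4 * dot p p
    + 4 / c * w ^+ 2 * dot G G.
Proof.
move=> c0 sw; have w0 : 0 <= w := le_trans (normr_ge0 s) sw.
have ha : 2 * (s * dot G a) <= w * (dot G G + dot a a).
  rewrite mulrCA; apply: (le_trans (ler_norm _)); rewrite normrM.
  apply: ler_pM => //; rewrite normrM ger0_norm//; exact: ler_normM_dot.
have hp : 2 * (s * dot G p) <= c / 4 * dot p p + 4 / c * w ^+ 2 * dot G G.
  have := dot_ge0 ((c / 2) *: p - (2 * s) *: G); rewrite !dotE (dotC p G) => hs.
  have ss : s ^+ 2 <= w ^+ 2.
    by rewrite -real_normK ?num_real// ler_pXn2r ?nnegrE.
  have hw := ler_wpM2r (dot_ge0 G) ss.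
  rewrite -(ler_pM2l c0).
  have -> : c * (c / 4 * dot p p + 4 / c * w ^+ 2 * dot G G) =
            c ^+ 2 / 4 * dot p p + 4 * (w ^+ 2 * dot G G) by field; rewrite gt_eqF.
  lra.
by rewrite dotDr mulrDr mulrDr -addrA; exact: lerD.
Qed.

Section iterates.
Variables (R : realType) (d d' : nat) (f : 'cV[R]_d -> R) (L : R)
  (g : 'cV[R]_d -> \bar R) (h : 'cV[R]_d' -> \bar R) (A : 'M[R]_(d', d))
  (lambda mu alpha beta K : R) (lambda_ mu_ : nat -> R)
  (u : nat -> 'cV[R]_d) (v : nat -> 'cV[R]_d').
Hypothesis f_convex : convex_function (E := 'cV[R]_d) setT f.
Hypothesis f_diff : forall x : 'cV[R]_d, differentiable f x.
Hypothesis f_lip : forall x y : 'cV[R]_d,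
  enorm (gradient f x - gradient f y) <= L * enorm (x - y).
Hypotheses (g_pcc : proper_convex_closed g) (h_pcc : proper_convex_closed h).
Hypotheses (lambda_gt0 : 0 < lambda) (mu_gt0 : 0 < mu).
Hypotheses (alpha_gt0 : 0 < alpha) (beta_gt0 : 0 < beta) (L_ge0 : 0 <= L).
Hypothesis AK : forall x, dot (A *m x) (A *m x) <= K * dot x x.
Hypotheses (K_ge0 : 0 <= K) (stepK : beta * K < alpha^-1 - L / 2).
Hypotheses (lambda_n_gt0 : forall n, 0 < lambda_ n)
  (mu_n_gt0 : forall n, 0 < mu_ n).
Hypothesis u_sub : forall n, subdifferential g (u n.+1)
  ((alpha * lambda_ n)^-1 *: (u n - alpha *: gradient f (u n)
     - (alpha * mu_ n) *: (A^T *m v n) - u n.+1)).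
Hypothesis v_sub : forall n, subdifferential h
  ((beta / mu_ n)^-1 *:
    (v n + (beta / mu_ n) *: (A *m (2 *: u n.+1 - u n)) - v n.+1)) (v n.+1).

(** Both [mu_ n] and [mu_ n.+1] enter because the energy is re-weighted between
    consecutive steps. *)
Definition param_error n :=
  `|lambda_ n - lambda| + `|mu_ n - mu| + `|mu_ n.+1 - mu|.

Variable B : R.
Hypothesis error_sum : forall n, \sum_(0 <= k < n) param_error k <= B.

Lemma param_error_ge0 n : 0 <= param_error n.
Proof. by rewrite !addr_ge0. Qed.

Lemma param_error_cvg0 : param_error n @[n --> \oo] --> (0 : R).
Proof.
exact/cvg_series_cvg_0/(partial_bound_cvg param_error_ge0 error_sum).
Qed.

Lemma param_error_le n : param_error n <= B.
Proof.
apply: le_trans (error_sum n.+1); rewrite big_nat_recr//= lerDr.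
by apply: sumr_ge0 => k _; exact: param_error_ge0.
Qed.

Lemma cvg_of_param_error (e : nat -> R) (l : R) :
  (forall n, `|e n - l| <= param_error n) -> e n @[n --> \oo] --> l.
Proof.
move=> el; apply/subr_cvg0/norm_cvg0P.
apply: (squeeze_cvgr _ (cvg_cst 0) param_error_cvg0).
by apply: nearW => n; rewrite normr_ge0 el.
Qed.

Lemma lambda_cvg : lambda_ n @[n --> \oo] --> lambda.
Proof.
by apply: cvg_of_param_error => n; rewrite /param_error -addrA lerDl addr_ge0.
Qed.

Lemma mu_cvg : mu_ n @[n --> \oo] --> mu.
Proof.
apply: cvg_of_param_error => n.
by rewrite /param_error addrAC lerDr addr_ge0.
Qed.

Definition dist_energy x y n := energy A alpha beta (mu_ n) (u n - x) (v n - y).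

Definition step_sqr n :=
  dot (u n.+1 - u n) (u n.+1 - u n) + dot (v n.+1 - v n) (v n.+1 - v n).

Lemma step_sqr_ge0 n : 0 <= step_sqr n.
Proof. by rewrite addr_ge0 ?dot_ge0. Qed.

Lemma energy_ge_dist : exists2 c, 0 < c & forall n a b,
  c * (dot a a + dot b b) <= energy A alpha beta (mu_ n) a b - L / 2 * dot a a.
Proof.
have [m0 m00 m0mu] := cvg_pos_lbound mu_n_gt0 mu_gt0 mu_cvg.
have [c c0 cP] := energy_coercive beta_gt0 AK K_ge0 m00 stepK.
by exists c => // n a b; exact: cP.
Qed.

(** Half of the decrease along the step pays for the perturbation at the new
    point; the rest of the perturbation and the change of [mu_] are
    relative errors by coercivity, and a constant times the parameter error. *)
Lemma energy_quasi_decrease c x y : 0 < c ->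
  (forall n a b, c * (dot a a + dot b b) <=
     energy A alpha beta (mu_ n) a b - L / 2 * dot a a) ->
  saddle f g h A lambda mu x y ->
  exists a k, [/\ 0 <= a, 0 <= k & forall n, dist_energy x y n.+1 <=
    (1 + a * param_error n) * dist_energy x y n + k * param_error n
    - c / 2 * step_sqr n].
Proof.
move=> c0 coer sad.
have B0 : 0 <= B := le_trans (param_error_ge0 0) (param_error_le 0).
have coer' n a b : c * (dot a a + dot b b) <= energy A alpha beta (mu_ n) a b.
  apply: (le_trans (coer n a b)); rewrite gerDl oppr_le0.
  by rewrite mulr_ge0 ?dot_ge0// divr_ge0.
(* [W] bounds the two perturbation coefficients of [energy_step] relative to
   the parameter error. *)
pose W := lambda^-1 + 1 + mu / lambda.
have li0 : 0 < lambda^-1 by rewrite invr_gt0.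
have W0 : 0 < W by rewrite addr_gt0 ?addr_gt0// divr_gt0.
set G1 := gradient f x; set G2 := A^T *m y.
pose D := dot G1 G1 + dot G2 G2.
have D0 : 0 <= D by rewrite addr_ge0 ?dot_ge0.
pose M := mu + B.
pose C := K + 1 + 2 * M / beta.
have C0 : 0 <= C.
  by rewrite addr_ge0 ?addr_ge0// divr_ge0 ?(ltW beta_gt0)// mulr_ge0// addr_ge0// ltW.
(* Relative error [a1] from the change of [mu_], relative and absolute errors
   [b1] and [k1] from the perturbation; terms quadratic in the parameter error
   are made linear by bounding one factor by [B]. *)
pose a1 := C / c; pose b1 := 2 * W / c.
pose k1 := W * D + 4 / c * W ^+ 2 * B * D.
have a10 : 0 <= a1 by rewrite divr_ge0 ?(ltW c0).
have b10 : 0 <= b1 by rewrite divr_ge0 ?mulr_ge0 ?(ltW c0) ?(ltW W0).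
have k10 : 0 <= k1.
  by rewrite addr_ge0 ?mulr_ge0 ?invr_ge0 ?exprn_ge0 ?(ltW W0) ?(ltW c0).
exists (a1 + b1 + a1 * b1 * B), (k1 + a1 * k1 * B).
split.
- by rewrite 2?addr_ge0 ?(mulr_ge0 (mulr_ge0 a10 b10) B0).
- by rewrite addr_ge0 ?(mulr_ge0 (mulr_ge0 a10 k10) B0).
move=> n.
set e := param_error n.
have e0 : 0 <= e := param_error_ge0 n; have eB : e <= B := param_error_le n.
have eE : e = `|lambda_ n - lambda| + `|mu_ n - mu| + `|mu_ n.+1 - mu| by [].
have [n1 n2 n3] : [/\ 0 <= `|lambda_ n - lambda|, 0 <= `|mu_ n - mu|
  & 0 <= `|mu_ n.+1 - mu|] by [].
have muM k : 0 <= mu_ k <= M.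
  rewrite (ltW (mu_n_gt0 k))/= -lerBlDl; apply: le_trans (ler_norm _) _.
  apply: le_trans (param_error_le k).
  by rewrite /param_error addrAC lerDr addr_ge0.
have s1 : `|lambda_ n / lambda - 1| <= W * e.
  have -> : lambda_ n / lambda - 1 = lambda^-1 * (lambda_ n - lambda).
    by rewrite mulrBr mulVf ?gt_eqF// mulrC.
  rewrite normrM gtr0_norm//; apply: ler_pM => //; first exact: ltW.
    by rewrite /W -addrA lerDl addr_ge0// divr_ge0// ltW.
  by rewrite eE -addrA lerDl addr_ge0.
have s2 : `|lambda_ n * mu / lambda - mu_ n| <= W * e.
  have -> : lambda_ n * mu / lambda - mu_ n =
      mu / lambda * (lambda_ n - lambda) - (mu_ n - mu).
    by field; rewrite gt_eqF.
  apply: (le_trans (ler_normB _ _)); rewrite normrM.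
  rewrite (@ger0_norm _ (mu / lambda)) ?divr_ge0 ?(ltW mu_gt0) ?(ltW lambda_gt0)//.
  have ml0 : 0 <= mu / lambda by rewrite divr_ge0 ?ltW.
  have := mulr_ge0 ml0 n2; have := mulr_ge0 ml0 n3; have := mulr_ge0 (ltW li0) e0.
  by rewrite /W eE; lra.
have p1 := perturbation_bound G1 (u n - x) (u n.+1 - u n) c0 s1.
have p2 := perturbation_bound G2 (u n - x) (u n.+1 - u n) c0 s2.
have uE : u n - x + (u n.+1 - u n) = u n.+1 - x by rewrite addrC addrA subrK.
rewrite uE in p1 p2.
have stepE := energy_step f_convex f_diff f_lip g_pcc h_pcc lambda_gt0
  alpha_gt0 beta_gt0 (lambda_n_gt0 n) (mu_n_gt0 n) sad (u_sub n) (v_sub n).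
rewrite -/G1 -/G2 in stepE.
have cstep := coer n (u n.+1 - u n) (v n.+1 - v n).
have cold := coer' n (u n - x) (v n - y).
have cnew := coer' n (u n.+1 - x) (v n.+1 - y).
set Y := energy A alpha beta (mu_ n) (u n.+1 - x) (v n.+1 - y) in stepE cnew.
have vold0 := dot_ge0 (v n - y); have vstep0 := dot_ge0 (v n.+1 - v n).
have ustep0 := dot_ge0 (u n.+1 - u n).
have Yle : Y <= (1 + b1 * e) * dist_energy x y n + k1 * e - c / 2 * step_sqr n.
  have uold : 2 * W * e * dot (u n - x) (u n - x) <= b1 * e * dist_energy x y n.
    have -> : b1 * e * dist_energy x y n = 2 * W * e * (dist_energy x y n / c).
      by rewrite /b1; field; rewrite gt_eqF.
    apply: ler_wpM2l; first by rewrite !mulr_ge0// ltW.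
    by rewrite ler_pdivlMr// mulrC; apply: le_trans cold; rewrite ler_pM2l// lerDl.
  have ee : 4 / c * (W * e) ^+ 2 * D <= 4 / c * W ^+ 2 * B * D * e.
    have -> : 4 / c * W ^+ 2 * B * D * e = 4 / c * W ^+ 2 * D * (B * e) by ring.
    have -> : 4 / c * (W * e) ^+ 2 * D = 4 / c * W ^+ 2 * D * (e * e) by ring.
    apply: ler_wpM2l; last exact: ler_wpM2r.
    by rewrite !mulr_ge0 ?invr_ge0 ?exprn_ge0 ?(ltW W0) ?(ltW c0).
  have cv := mulr_ge0 (ltW c0) vstep0.
  move: stepE p1 p2 cstep uold ee cv; rewrite /dist_energy /step_sqr /k1 /D.
  lra.
have change := energy_change alpha beta_gt0 AK K_ge0
  (u n.+1 - x) (v n.+1 - y) (muM n) (muM n.+1).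
have newY : dist_energy x y n.+1 <= (1 + a1 * e) * Y.
  apply: (le_trans change); rewrite -/Y -/C [leRHS]mulrDl mul1r lerD2l.
  have -> : a1 * e * Y = C * e * (Y / c) by rewrite /a1; field; rewrite gt_eqF.
  apply: ler_pM; [by rewrite mulr_ge0|by rewrite addr_ge0 ?dot_ge0| |].
    apply: ler_wpM2l => //.
    have := ler_distD mu (mu_ n.+1) (mu_ n); rewrite (distrC mu) eE; lra.
  by rewrite ler_pdivlMr// mulrC.
have x0 : 0 <= dist_energy x y n.
  by apply: le_trans cold; rewrite mulr_ge0 ?addr_ge0 ?dot_ge0// ltW.
apply: (le_trans newY).
have ae1 : 0 <= 1 + a1 * e by rewrite addr_ge0// mulr_ge0.
apply: (le_trans (ler_wpM2l ae1 Yle)).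
set X := dist_energy x y n in x0 *; set S := step_sqr n.
have cS : 0 <= c / 2 * S by rewrite mulr_ge0 ?divr_ge0 ?step_sqr_ge0 ?(ltW c0).
have eeB : 0 <= B * e - e * e by rewrite -mulrBl mulr_ge0// subr_ge0.
have h1 := mulr_ge0 (mulr_ge0 (mulr_ge0 a10 b10) x0) eeB.
have h2 := mulr_ge0 (mulr_ge0 a10 k10) eeB.
have h3 := mulr_ge0 (mulr_ge0 a10 e0) cS.
lra.
Qed.

Lemma dist_energy_ge c x y n : (forall n a b, c * (dot a a + dot b b) <=
     energy A alpha beta (mu_ n) a b - L / 2 * dot a a) ->
  c * (dot (u n - x) (u n - x) + dot (v n - y) (v n - y)) <= dist_energy x y n.
Proof.
move=> coer; apply: (le_trans (coer n _ _)); rewrite /dist_energy gerDl oppr_le0.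
by rewrite mulr_ge0 ?dot_ge0// divr_ge0.
Qed.

Lemma dist_energy_cvg x y : saddle f g h A lambda mu x y ->
  cvgn (dist_energy x y) /\ step_sqr n @[n --> \oo] --> (0 : R).
Proof.
move=> sad; have [c c0 coer] := energy_ge_dist.
have [a [k [a0 k0 decr]]] := energy_quasi_decrease c0 coer sad.
have E0 n : 0 <= dist_energy x y n.
  apply: le_trans (dist_energy_ge x y n coer).
  by rewrite mulr_ge0 ?addr_ge0 ?dot_ge0// ltW.
have S0 n : 0 <= c / 2 * step_sqr n.
  by rewrite mulr_ge0 ?divr_ge0 ?step_sqr_ge0// ltW.
have [Ecvg Scvg] :=
  quasi_decreasing_cvg a0 k0 E0 param_error_ge0 S0 error_sum decr.
split=> //; rewrite -(mulr0 (2 / c)).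
have -> : step_sqr = fun n => 2 / c * (c / 2 * step_sqr n).
  by apply/funext => n; field; rewrite gt_eqF.
by apply: cvgM => //; exact: cvg_cst.
Qed.

(** The optimality conditions of the two proximal steps pass to the limit along
    a convergent subsequence because the steps vanish and the subdifferentials
    have closed graphs. *)
Lemma cluster_saddle (s : nat -> nat) x y : s n @[n --> \oo] --> \oo ->
  step_sqr n @[n --> \oo] --> (0 : R) ->
  u (s n) @[n --> \oo] --> x -> v (s n) @[n --> \oo] --> y ->
  saddle f g h A lambda mu x y.
Proof.
move=> sinf step0 ux vy; have [[gp _ gc] [hp _ hc]] := (g_pcc, h_pcc).
have along (e : nat -> R) (l : R) : e n @[n --> \oo] --> l -> e (s n) @[n --> \oo] --> l.
  by move=> el; exact: (cvg_comp _ _ sinf el).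
have du0 : u (s n).+1 - u (s n) @[n --> \oo] --> (0 : 'cV[R]_d).
  apply: cvg_dot0; apply: (squeeze_cvgr _ (cvg_cst 0) (along _ _ step0)).
  by apply: nearW => n; rewrite subr0 dot_ge0 lerDl dot_ge0.
have dv0 : v (s n).+1 - v (s n) @[n --> \oo] --> (0 : 'cV[R]_d').
  apply: cvg_dot0; apply: (squeeze_cvgr _ (cvg_cst 0) (along _ _ step0)).
  by apply: nearW => n; rewrite subr0 dot_ge0 lerDr dot_ge0.
have ux' : u (s n).+1 @[n --> \oo] --> x.
  rewrite -[x]add0r; under eq_fun => n do rewrite -[u (s n).+1](subrK (u (s n))).
  exact: cvgD.
have vy' : v (s n).+1 @[n --> \oo] --> y.
  rewrite -[y]add0r; under eq_fun => n do rewrite -[v (s n).+1](subrK (v (s n))).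
  exact: cvgD.
have lc := along _ _ lambda_cvg; have mc := along _ _ mu_cvg.
split.
  apply: (subdifferential_closed _ gp gc ux' _ (fun n => u_sub (s n))).
  have -> : - (lambda^-1 *: (gradient f x + mu *: (A^T *m y))) =
      (alpha * lambda)^-1 *: (x - alpha *: gradient f x
         - (alpha * mu) *: (A^T *m y) - x).
    rewrite (addrAC _ _ (- x)) (addrAC x) subrr add0r -scalerA -scalerN -opprD.
    rewrite -scalerDr -[in RHS]scalerN scalerA invfM.
    by rewrite mulrAC mulVf ?gt_eqF// mul1r scalerN.
  apply: cvgZ; first apply: cvgV; first by rewrite mulf_neq0 ?gt_eqF.
    by apply: cvgM => //; exact: cvg_cst.
  apply: cvgB => //; apply: cvgB; first apply: cvgB => //.
    by apply: cvgZ; [exact: cvg_cst|exact: (gradient_cvg f_lip)].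
  apply: cvgZ; last exact: cvg_mulmx.
  by apply: cvgM => //; exact: cvg_cst.
apply: (subdifferential_closed _ hp hc _ vy' (fun n => v_sub (s n))).
have -> : A *m x = (beta / mu)^-1 *: (y + (beta / mu) *: (A *m (2 *: x - x)) - y).
  rewrite addrAC subrr add0r scalerA mulVf ?scale1r; last first.
    by rewrite mulf_neq0 ?invr_neq0 ?gt_eqF.
  by rewrite scaler_nat mulr2n addrK.
have bc : beta / mu_ (s n) @[n --> \oo] --> beta / mu.
  by apply: cvgM; [exact: cvg_cst|apply: cvgV => //; rewrite gt_eqF].
apply: cvgZ; first apply: cvgV => //.
  by rewrite mulf_neq0 ?invr_neq0 ?gt_eqF.
apply: cvgB => //; apply: cvgD => //; apply: cvgZ => //.
apply: cvg_mulmx; apply: cvgB => //; apply: cvgZ => //; exact: cvg_cst.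
Qed.

(** The energy relative to the given saddle only serves to bound the iterates
    and to make the steps vanish; the limit is found as a cluster point, and the
    energy relative to that point then tends to [0]. *)
Theorem iterates_cvg_saddle x0 y0 : saddle f g h A lambda mu x0 y0 ->
  exists x y, saddle f g h A lambda mu x y /\ u n @[n --> \oo] --> x.
Proof.
move=> sad0; have [c c0 coer] := energy_ge_dist.
have [Ecvg step0] := dist_energy_cvg sad0.
have [M EM] : exists M, forall n, dist_energy x0 y0 n <= M.
  have /cvg_seq_bounded/ex_strict_bound_gt0[M M0 EM] := Ecvg.
  by exists M => n; apply: le_trans (ler_norm _) _; exact/ltW/EM.
have bnd n : dot (u n - x0) (u n - x0) + dot (v n - y0) (v n - y0) <= M / c.
  rewrite ler_pdivlMr// mulrC; apply: le_trans (EM n).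
  exact: dist_energy_ge.
have ubnd n : dot (u n) (u n) <= 2 * (M / c) + 2 * dot x0 x0.
  have := dotD_le (u n - x0) x0; rewrite subrK.
  have := bnd n; have := dot_ge0 (v n - y0); lra.
have vbnd n : dot (v n) (v n) <= 2 * (M / c) + 2 * dot y0 y0.
  have := dotD_le (v n - y0) y0; rewrite subrK.
  have := bnd n; have := dot_ge0 (u n - x0); lra.
have [s sinf [x sx]] := bounded_subsequence ubnd.
have [r rinf [y ry]] := bounded_subsequence (fun n => vbnd (s n)).
pose t n := s (r n).
have tinf : t n @[n --> \oo] --> \oo := cvg_comp _ _ rinf sinf.
have tx : u (t n) @[n --> \oo] --> x := cvg_comp _ _ rinf sx.
have sad := cluster_saddle tinf step0 tx ry.
exists x, y; split => //.
have [/cvg_ex[l El] _] := dist_energy_cvg sad.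
have l0 : l = 0.
  have E1 : dist_energy x y (t n) @[n --> \oo] --> l := cvg_comp _ _ tinf El.
  have E2 : dist_energy x y (t n) @[n --> \oo] --> energy A alpha beta mu (x - x) (y - y).
    apply: cvg_energy; first exact: (cvg_comp _ _ tinf mu_cvg).
      by apply: cvgB => //; exact: cvg_cst.
    by apply: cvgB => //; exact: cvg_cst.
  have -> := cvg_unique (@Rhausdorff R) E1 E2.
  by rewrite /energy !subrr mulmx0 !dot0l !mulr0 subr0 addr0.
apply: cvg_dot0.
have El' : dist_energy x y n / c @[n --> \oo] --> (0 : R).
  by rewrite -(mul0r c^-1) -{1}l0; apply: cvgM => //; exact: cvg_cst.
apply: (squeeze_cvgr _ (cvg_cst 0) El').
apply: nearW => n; rewrite dot_ge0/= ler_pdivlMr// mulrC.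
apply: le_trans (dist_energy_ge x y n coer).
by rewrite ler_pM2l// lerDl dot_ge0.
Qed.

End iterates.

Unset Implicit Arguments.

Theorem theorem3p5 (R : realType) (d d' : nat)
  (f : 'cV[R]_d -> R) (L : R)
  (g : 'cV[R]_d -> \bar R) (h : 'cV[R]_d' -> \bar R)
  (A : 'M[R]_(d', d)) (lambda mu : R)
  (f_convex : convex_function (E := 'cV[R]_d) setT f)
  (f_diff : forall x : 'cV[R]_d, differentiable f x)
  (f_lip : forall x y : 'cV[R]_d,
    enorm (gradient f x - gradient f y) <= L * enorm (x - y))
  (g_pcc : proper_convex_closed g) (h_pcc : proper_convex_closed h)
  (lambda_gt0 : 0 < lambda) (mu_gt0 : 0 < mu)
  (subdiff_sum : forall u : 'cV[R]_d,
    subdifferential (fun w => lambda%:E * g w + mu%:E * h (A *m w))%E u =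
    [set lambda *: p + mu *: (A^T *m q) |
       p in subdifferential g u & q in subdifferential h (A *m u)])
  (has_min : exists uhat : 'cV[R]_d,
    argmin (objective f g h A lambda mu) uhat /\
    (objective f g h A lambda mu uhat < +oo)%E)
  (alpha beta : R) (alpha_gt0 : 0 < alpha) (beta_gt0 : 0 < beta)
  (step_cond : beta * spectral_norm A ^+ 2 < alpha^-1 - L / 2)
  (lambda_ mu_ : nat -> R)
  (lambda_n_gt0 : forall n, 0 < lambda_ n) (mu_n_gt0 : forall n, 0 < mu_ n)
  (lambda_summable : (\sum_(0 <= n <oo) `|lambda_ n - lambda|%:E < +oo)%E)
  (mu_summable : (\sum_(0 <= n <oo) `|mu_ n - mu|%:E < +oo)%E)
  (u0 : 'cV[R]_d) (v0 : 'cV[R]_d')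
  (u : nat -> 'cV[R]_d) (v : nat -> 'cV[R]_d')
  (u_init : u 0%N = u0) (v_init : v 0%N = v0)
  (u_step : forall n, u n.+1 =
    prox (fun w => (alpha * lambda_ n)%:E * g w)%E
      (u n - alpha *: gradient f (u n) - (alpha * mu_ n) *: (A^T *m v n)))
  (v_step : forall n, v n.+1 =
    prox (fun w => (beta / mu_ n)%:E * conjugate h w)%E
      (v n + (beta / mu_ n) *: (A *m (2 *: u n.+1 - u n)))) :
  exists2 ubar : 'cV[R]_d,
    argmin (objective f g h A lambda mu) ubar & u n @[n --> \oo] --> ubar.
Proof.
have [uhat [umin ufin]] := has_min.
(* In dimension [0] the Lipschitz bound does not force [0 <= L]. *)
have [d0|d_gt0] := posnP d.
  exists uhat => //; have -> : u = fun=> uhat; last exact: cvg_cst.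
  by apply/funext => n; apply/colP => -[i i_lt]; exfalso; move: i_lt; rewrite d0.
have L_ge0 : 0 <= L.
  pose e : 'cV[R]_d := \col_i 1.
  have e0 : 0 < enorm (e - 0).
    rewrite sqrtr_gt0 subr0 lt_def dot_ge0 andbT; apply/eqP => /dot_eq0 /colP.
    by move=> /(_ (Ordinal d_gt0)); rewrite !mxE => /eqP; rewrite oner_eq0.
  by rewrite -(pmulr_lge0 _ e0); apply: le_trans (f_lip e 0); exact: enorm_ge0.
have [vhat sad] := saddle_exists f_diff f_lip g_pcc h_pcc lambda_gt0 mu_gt0
  subdiff_sum umin ufin.
have [gsub hsub] := sad.
have [Bl Blambda] := nneseries_partial_bound (fun n => normr_ge0 _) lambda_summable.
have [Bm Bmu] := nneseries_partial_bound (fun n => normr_ge0 _) mu_summable.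
have errB n : \sum_(0 <= k < n) param_error lambda mu lambda_ mu_ k <= Bl + Bm + Bm.
  rewrite /param_error !big_split/=; apply: lerD; first exact: lerD.
  apply: le_trans (Bmu n.+1); rewrite big_nat_recl// lerDr; exact: normr_ge0.
have u_sub n : subdifferential g (u n.+1)
    ((alpha * lambda_ n)^-1 *: (u n - alpha *: gradient f (u n)
       - (alpha * mu_ n) *: (A^T *m v n) - u n.+1)).
  by rewrite u_step; apply: prox_subgradient gsub => //; rewrite mulr_gt0.
have v_sub n : subdifferential h ((beta / mu_ n)^-1 *:
    (v n + (beta / mu_ n) *: (A *m (2 *: u n.+1 - u n)) - v n.+1)) (v n.+1).
  rewrite [v n.+1]v_step.
  by apply: prox_conjugate_subgradient hsub => //; rewrite divr_gt0.
have [x [y [sadx ux]]] := iterates_cvg_saddle f_convex f_diff f_lip g_pcc h_pcc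
  lambda_gt0 mu_gt0 alpha_gt0 beta_gt0 L_ge0 (@spectral_norm_bound R d' d A)
  (sqr_ge0 _) step_cond lambda_n_gt0 mu_n_gt0 u_sub v_sub errB sad.
by exists x => //; exact: (saddle_argmin f_convex f_diff f_lip g_pcc h_pcc
  lambda_gt0 mu_gt0 sadx).
Qed.
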